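(* Consider the \textsc{Normal Domination Game} and let $n\geq 0$. The nimbers of the paths $P_1$, $P_2$ and $P_3$ are $1$, $1$ and $2$, respectively. Moreover, if $n\geq 4$, then the nimber of $P_n$ is $0$, $1$, $1$ or $3$ according as $n \bmod 4$ is $0$, $1$, $2$ or $3$, respectively. Consequently, Bob (the second player) wins the \textsc{Normal Domination Game} on the path $P_n$ if and only if $n$ is a multiple of $4$.
   Context: $P_n$ is the path with vertices $v_1,\dots,v_n$ and edges $v_1v_2,\dots,v_{n-1}v_n$. A vertex dominates itself and its neighbors. In the \textsc{Normal Domination Game} on a graph $G$, Alice (first) and Bob alternately select playable vertices, where a vertex is playable if it dominates at least one vertex not dominated by previously selected vertices; the game ends when no vertex is playable, and the last player to move wins. This is an impartial game. The nimber (Sprague–Grundy value) of a position is defined recursively as the minimum excludant $\mathrm{mex}$ (least non-negative integer not in the set) of the set of nimbers of the positions reachable in one move; a position with no moves has nimber $0$. The first player wins from a position iff its nimber is nonzero. *)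

(* Defs.v *)
From mathcomp Require Import all_boot.

Set Implicit Arguments.
Unset Strict Implicit.
Unset Printing Implicit Defensive.

Record sgraph := SGraph {
  vertex :> finType;
  edge : rel vertex;
  edge_sym : symmetric edge;
  edge_irr : irreflexive edge }.

Lemma mex_exists (s : seq nat) : exists k, k \notin s.
Proof.
exists (sumn s).+1; apply/negP => ms.
have /= e := perm_sumn (perm_to_rem ms).
by have := leq_addr (sumn (rem (sumn s).+1 s)) (sumn s).+1; rewrite -e ltnn.
Qed.

Definition mex (s : seq nat) : nat := ex_minn (mex_exists s).

Section DominationGame.
Variable G : sgraph.

Definition dominates (u v : G) : bool := (u == v) || edge u v.

(* A position is the set S of the vertices selected so far. *)
Definition dominated (S : {set G}) (w : G) : bool :=
  [exists u in S, dominates u w].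

Definition playable (S : {set G}) (v : G) : bool :=
  [exists w, dominates v w && ~~ dominated S w].

(* A playable vertex is not in S, so #|~: S| bounds the number of remaining
   moves and is enough fuel; nimberE below is the defining recursion. *)
Fixpoint nimber_rec (k : nat) (S : {set G}) : nat :=
  if k is k'.+1 then
    mex [seq nimber_rec k' (v |: S) | v <- enum G & playable S v]
  else 0.

Definition nimber (S : {set G}) : nat := nimber_rec #|~: S| S.

Lemma playable_notin S v : playable S v -> v \notin S.
Proof.
move=> /existsP[w /andP[vw /existsPn nw]]; apply/negP => vS.
by have := nw v; rewrite vS vw.
Qed.

Lemma mex_nil : mex [::] = 0.
Proof. by rewrite /mex; case: ex_minnP => [[//|k]] _ /(_ 0 isT). Qed.

Lemma nimberE S :
  nimber S = mex [seq nimber (v |: S) | v <- enum G & playable S v].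
Proof.
have cardC v : playable S v -> #|~: S| = #|~: (v |: S)|.+1.
  move=> /playable_notin vS.
  have vC : v \in ~: S by rewrite inE.
  by rewrite (cardsD1 v) vC add1n setCU setIC -setDE.
rewrite {1}/nimber; case E: #|~: S| => [|k] /=.
  rewrite (_ : [seq v <- enum G | _] = [::]) ?mex_nil //.
  apply/eqP; rewrite -(negbK (_ == _)) -has_filter; apply/hasPn => v _.
  by apply/negP => /cardC; rewrite E.
congr mex; apply/eq_in_map => v; rewrite mem_filter => /andP[/cardC + _].
by rewrite E /nimber => -[<-].
Qed.

Inductive player := Alice | Bob.

Definition opponent (p : player) : player :=
  if p is Alice then Bob else Alice.

(* winning p q S: p has a winning strategy from the position S when it is the
   turn of q.  In the first rule, no move is available to the opponent of p,
   so that p wins; this makes Bob the winner on the graph without vertices. *)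
Inductive winning (p : player) : player -> {set G} -> Prop :=
| winning_end S :
    (forall v, ~~ playable S v) -> winning p (opponent p) S
| winning_move S v :
    playable S v -> winning p (opponent p) (v |: S) -> winning p p S
| winning_reply S :
    (exists v, playable S v) ->
    (forall v, playable S v -> winning p p (v |: S)) ->
    winning p (opponent p) S.

Definition graph_nimber : nat := nimber set0.

Definition wins_game (p : player) : Prop := winning p Alice set0.

End DominationGame.

(* The vertex v_i of the path is the ordinal i - 1. *)
Definition path_rel (n : nat) : rel 'I_n :=
  fun i j => (i.+1 == j :> nat) || (j.+1 == i :> nat).

Lemma path_rel_sym n : symmetric (@path_rel n).
Proof. by move=> i j; rewrite /path_rel orbC. Qed.

Lemma path_rel_irr n : irreflexive (@path_rel n).
Proof. by move=> i; rewrite /path_rel orbb -[X in _ == X]addn0 -addn1 eqn_add2l. Qed.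

Definition path_graph (n : nat) : sgraph :=
  SGraph (@path_rel_sym n) (@path_rel_irr n).

(* Main.v *)
(* After the first move the undominated vertices of the path form maximal runs,
   separated by at least two dominated vertices, and the nimber of the position
   is the nim-sum of the run lengths mod 4.  Indeed a move shortens a single run,
   possibly splitting it: erasing one or three vertices changes the parity, and
   erasing two happens at the end of a run and changes the high bit.  Conversely
   every run has a dominated neighbour, from which one, two or three vertices
   can be erased, as in Nim.  The nimber of P_n is then the mex of the nim-sums
   of (i - 1) mod 4 and (n - i - 2) mod 4 over the first moves i < n. *)
Require Import Defs.
From mathcomp Require Import all_boot.
From mathcomp Require Import zify.

Set Implicit Arguments.
Unset Strict Implicit.
Unset Printing Implicit Defensive.

(** * Minimum excludants and outcomes of the game *)

Lemma mex_eq (s : seq nat) m :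
  (forall k, k < m -> k \in s) -> m \notin s -> mex s = m.
Proof.
move=> lt_m m_s; rewrite /mex; case: ex_minnP => k k_s min_k.
apply/eqP; rewrite eqn_leq min_k //= leqNgt; apply: contra k_s; exact: lt_m.
Qed.

Lemma mex_eq0 (s : seq nat) : (mex s == 0) = (0 \notin s).
Proof.
rewrite /mex; case: ex_minnP => k k_s min_k; apply/eqP/idP => [<- // | s0].
by apply/eqP; rewrite -leqn0 min_k.
Qed.

Section Outcome.
Variable G : sgraph.
Implicit Types (S : {set G}) (v : G).

Lemma card_play S v : playable S v -> #|~: (v |: S)| < #|~: S|.
Proof.
move=> /playable_notin vS; apply: proper_card.
rewrite properE; apply/andP; split.
  by apply/subsetP => x; rewrite !inE negb_or => /andP[].
by apply/subsetPn; exists v; rewrite !inE ?vS ?eqxx.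
Qed.

Lemma nimber_eq0P S :
  reflect (forall v, playable S v -> nimber (v |: S) <> 0) (nimber S == 0).
Proof.
rewrite nimberE mex_eq0; apply: (iffP idP) => [/negP S0 v pv v0 | H].
  by apply/S0/mapP; exists v => //; rewrite mem_filter pv mem_enum.
by apply/mapP => -[v]; rewrite mem_filter => /andP[/H vN0 _] /esym.
Qed.

(** The two halves feed each other in one induction on the number of unselected vertices: from
    nimber 0 every move leads to a nonzero nimber, and from a nonzero nimber some move leads to
    0. *)
Lemma winning_nimber p S :
  (nimber S = 0 -> winning p (opponent p) S) /\
  (nimber S <> 0 -> winning p p S).
Proof.
have [m] := ubnP #|~: S|; elim: m S => // m IHm S ltSm.
have IH v : playable S v ->
    (nimber (v |: S) = 0 -> winning p (opponent p) (v |: S)) /\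
    (nimber (v |: S) <> 0 -> winning p p (v |: S)).
  by move=> pv; apply: IHm; apply: leq_trans (card_play pv) _.
split=> [/eqP/nimber_eq0P S0 | /eqP].
  case: (boolP [exists v, playable S v]) => [/existsP ex | /existsPn no].
    by apply: winning_reply => // v pv; apply: (IH v pv).2; apply: S0.
  exact: winning_end.
rewrite nimberE mex_eq0 negbK => /mapP[v]; rewrite mem_filter => /andP[pv _].
by move=> /esym v0; apply: (winning_move pv); apply: (IH v pv).1.
Qed.

(** The converse, by induction on the strategy; [pNop] discards the half that does not match the
    turn. *)
Lemma nimber_winning p q S : winning p q S ->
  (q = p -> nimber S <> 0) /\ (q = opponent p -> nimber S = 0).
Proof.
have pNop : p <> opponent p by case: p.
elim=> {q S} [S no | S v pv _ [_ /(_ erefl) v0] | S _ _ IH].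
- split=> [/esym // | _]; apply/eqP/nimber_eq0P => v.
  by rewrite (negPf (no v)).
- by split=> [_ /eqP/nimber_eq0P/(_ v pv) | //].
- split=> [/esym // | _]; apply/eqP/nimber_eq0P => v pv.
  exact: (IH v pv).1.
Qed.

Lemma wins_game_Bob : wins_game G Bob <-> graph_nimber G = 0.
Proof.
split=> [/nimber_winning[_] | S0]; first exact.
exact: (winning_nimber Bob set0).1.
Qed.

End Outcome.

(** * Nim values of binary words *)

(* The pair (h, l) stands for the nimber 2h + l. *)
Definition nim_add (a b : bool * bool) := (a.1 (+) b.1, a.2 (+) b.2).
Definition nim_nat (a : bool * bool) : nat := a.1.*2 + a.2.
Definition nim_mod4 (c : nat) : bool * bool := (odd c./2, odd c).

Lemma nim_addA : associative nim_add.
Proof. by move=> [a a'] [b b'] [c c']; rewrite /nim_add /= !addbA. Qed.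

Lemma nim_addC : commutative nim_add.
Proof. by move=> [a a'] [b b']; rewrite /nim_add /= addbC [a' (+) _]addbC. Qed.

Lemma nim_add0 a : nim_add (false, false) a = a.
Proof. by case: a. Qed.

Lemma nim_nat_inj : injective nim_nat.
Proof. by move=> [[] []] [[] []]. Qed.

(** Adding 2 modulo 4 flips the high bit and keeps the low one, so it agrees with the nim-sum with
    2. *)
Lemma nim_mod4_add2 c : nim_mod4 c.+2 = nim_add (true, false) (nim_mod4 c).
Proof. by rewrite /nim_mod4 /nim_add /= negbK. Qed.

Lemma nim_mod4_modn c : nim_mod4 c = nim_mod4 (c %% 4).
Proof.
rewrite {1}(divn_eq c 4); elim: (c %/ 4) => [|q IHq]; first by [].
by rewrite mulSn -addnA !addSn add0n !nim_mod4_add2 IHq nim_addA nim_add0.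
Qed.

(* The nim-sum, over the maximal runs of true, of the run lengths mod 4; the
   first run is lengthened by c. *)
Fixpoint word_nim (c : nat) (w : seq bool) : bool * bool :=
  match w with
  | [::] => nim_mod4 c
  | true :: w' => word_nim c.+1 w'
  | false :: w' => nim_add (nim_mod4 c) (word_nim 0 w')
  end.

(** A letter [false] closes the last run of [u], so the runs on its two sides contribute
    separately. *)
Lemma word_nim_cat c u w :
  word_nim c (u ++ false :: w) = nim_add (word_nim c u) (word_nim 0 w).
Proof. by elim: u c => [|[] u IHu] c //=; rewrite IHu nim_addA. Qed.

Lemma word_nim_nseq c k w : word_nim c (nseq k true ++ w) = word_nim (c + k) w.
Proof. by elim: k c => [|k IHk] c /=; rewrite ?addn0 ?IHk ?addSnnS. Qed.

Lemma word_nim_add2 c w :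
  word_nim c.+2 w = nim_add (true, false) (word_nim c w).
Proof.
elim: w c => [|[] w IHw] c; rewrite /= ?IHw ?nim_mod4_add2 //.
by rewrite nim_addA.
Qed.

Lemma word_nim_rcons2 c u :
  word_nim c (u ++ [:: true; true]) = nim_add (true, false) (word_nim c u).
Proof.
elim: u c => [|[] u IHu] c; rewrite /= ?IHu ?nim_mod4_add2 //.
by rewrite !nim_addA [nim_add _ (true, _)]nim_addC.
Qed.

(** Nim-addition has no carries, so its low bit is the parity of the total length of the runs. *)
Lemma word_nim_odd c w : (word_nim c w).2 = odd c (+) odd (count id w).
Proof.
elim: w c => [|[] w IHw] c; rewrite /= ?addbF ?IHw //=.
by rewrite addNb addbN oddD.
Qed.

(* Erasing an odd number of letters changes the parity; TTF and FTT shorten a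
   single run by 2, which changes the high bit. *)
Lemma word_nim_erase u a b c w :
  [|| a, b | c] -> [:: a; b; c] <> [:: true; false; true] ->
  word_nim 0 (u ++ [:: false; false; false] ++ w) <>
  word_nim 0 (u ++ [:: a; b; c] ++ w).
Proof.
move=> abc nTFT.
have par : odd (a + (b + c)) -> word_nim 0 (u ++ [:: false; false; false] ++ w) <>
  word_nim 0 (u ++ [:: a; b; c] ++ w).
  move=> odd_abc /(congr1 snd); rewrite !word_nim_odd !count_cat /= !addn0 !add0n.
  move: odd_abc; rewrite !oddD !oddb.
  by case: (odd (count id u)) (odd (count id w)) a b c {abc nTFT} => [] [] [] [] [].
have hi x y z : nim_add x (nim_add y z) = nim_add y (nim_add x z).
  by rewrite !nim_addA [nim_add x y]nim_addC.
have toggle x : x <> nim_add (true, false) x by case: x => [[] []].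
case: a b c abc nTFT par => [] [] [] //= _ nTFT par; try exact: par.
- rewrite -[u ++ [:: true, true & _]]/(u ++ ([:: true; true] ++ false :: w)) catA.
  rewrite !word_nim_cat word_nim_rcons2 /= !nim_add0 -nim_addA; exact: toggle.
- rewrite !word_nim_cat /= !nim_add0 word_nim_add2 hi; exact: toggle.
Qed.

(** * The strategy of Nim on words *)

(** As [bit] is additive, a nim-sum with this bit set contains a run with it set. The padding
    delimits every run on both sides; the last clause covers a run that touches both paddings. *)
Lemma word_nim_run (bit : bool * bool -> bool) w :
    (forall x y, bit (nim_add x y) = bit x (+) bit y) ->
    bit (word_nim 0 w) ->
  exists u k v, [/\ false :: w ++ [:: false] =
                      u ++ false :: nseq k true ++ false :: v,
                    bit (nim_mod4 k) &
                    u ++ v = [::] -> w = nseq k true].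
Proof.
move=> bitD; have bit0 : bit (false, false) = false.
  by have := bitD (false, false) (false, false); rewrite addbb.
have [m] := ubnP (size w); elim: m w => // m IHm w ltwm bw.
have [/all_pred1P w1 | /allPn /=] := boolP (all (pred1 true) w).
  exists [::], (size w), [::]; split=> //; first by rewrite {1}w1.
  by move: bw; rewrite w1 -[nseq _ _]cats0 word_nim_nseq size_cat size_nseq addn0.
move=> [x xw]; case: x xw => // wF _.
(* [k] is the length of the first run. If its bit is clear, the bit comes from the shorter rest
   [v]. *)
pose k := index false w.
have takek : take k w = nseq k true.
  have le_k : k <= size w by apply: index_size.
  apply: (@eq_from_nth _ true); first by rewrite size_nseq size_takel.
  move=> i; rewrite size_takel // => lt_ik.
  rewrite nth_take // nth_nseq lt_ik.
  by have /negbT /= := @before_find _ true (pred1 false) w i lt_ik; case: nth.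
have ew : w = nseq k true ++ false :: drop k.+1 w.
  by rewrite -takek -[in LHS](cat_take_drop k w) (drop_nth true) ?index_mem // nth_index.
move: (drop _ w) ew => v ew.
have [bk | bk] := boolP (bit (nim_mod4 k)).
  exists [::], k, (v ++ [:: false]); split=> //; first by rewrite ew -catA.
  by case: (v).
have [] := IHm v.
- by rewrite ltnS in ltwm; apply: leq_trans ltwm; rewrite ew size_cat /= addnS ltnS leq_addl.
- by move: bw; rewrite ew word_nim_nseq /= bitD (negPf bk).
move=> u [l] [v' [ev bl _]]; exists (false :: nseq k true ++ u), l, v'; split=> //.
by rewrite ew -catA /= ev -!catA.
Qed.

(* The winning strategy of Nim: the bit is the leading bit of the nim-sum of t
   and x, and a heap k having this bit is lowered by j. *)
Lemma nim_leading_bit t x : t < nim_nat x ->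
  exists bit : bool * bool -> bool,
  [/\ forall x y, bit (nim_add x y) = bit x (+) bit y, bit x &
      forall k, bit (nim_mod4 k) ->
        exists2 j, 0 < j <= 3 /\ j <= k &
        forall y z, nim_add y (nim_add (nim_mod4 k) z) = x ->
                    nim_nat (nim_add y (nim_add (nim_mod4 (k - j)) z)) = t].
Proof.
move=> lt_tx; have lt_t4 : t < 4 by apply: leq_trans lt_tx _; case: x => [[] []].
(* Since [t < nim_nat x < 4], the high bits differ exactly when [t < 2 <= nim_nat x]; otherwise only
   the low bits differ. *)
exists (if t < 2 <= nim_nat x then fst else snd); split.
- by case: ifP => _ [? ?] [? ?].
- by case: x lt_tx => [[] []] /=; case: t lt_t4 => [|[|[|[]]]].
move=> k; rewrite nim_mod4_modn => bk.
(* It suffices to lower the remainder [k %% 4], as [k - j] stays congruent to it modulo 4. *)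
suff [j j3 [jk H]] : exists2 j, 0 < j <= 3 & j <= k %% 4 /\ forall y z,
    nim_add y (nim_add (nim_mod4 (k %% 4)) z) = x ->
    nim_nat (nim_add y (nim_add (nim_mod4 (k %% 4 - j)) z)) = t.
  exists j; first by split=> //; lia.
  move=> y z e; rewrite -(H y z e).
  congr (nim_nat (nim_add _ (nim_add _ _))).
  by rewrite nim_mod4_modn [RHS]nim_mod4_modn; congr nim_mod4; lia.
move: (k %% 4) (ltn_pmod k (isT : 0 < 4)) bk => r.
case: x lt_tx => [[] []]; case: t lt_t4 => [|[|[|[|//]]]] _ //= _;
case: r => [|[|[|[|//]]]] _ //= _;
by [exists 1 => //; split=> // - [[] []] [[] []]
  | exists 2 => //; split=> // - [[] []] [[] []]
  | exists 3 => //; split=> // - [[] []] [[] []]].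
Qed.

Lemma word_nim_pad w : word_nim 0 (false :: w ++ [:: false]) = word_nim 0 w.
Proof. by rewrite /= nim_add0 word_nim_cat nim_addC; apply: nim_add0. Qed.

(* Lowering a run by j <= 3 is erasing three letters at the end of the run next
   to a letter false that is not the padding; there is one unless w is all true. *)
Lemma word_nim_reach w t :
    (forall u v, false :: w ++ [:: false] <> u ++ [:: true; false; true] ++ v) ->
    false \in w -> t < nim_nat (word_nim 0 w) ->
  exists u a b c v,
  [/\ false :: w ++ [:: false] = u ++ [:: a; b; c] ++ v, [|| a, b | c] &
      nim_nat (word_nim 0 (u ++ [:: false; false; false] ++ v)) = t].
Proof.
move=> nTFT wF lt_t.
have [bit [bitD bx low]] := nim_leading_bit lt_t.
have [u [k [v [ew bk uv]]]] := word_nim_run bitD bx.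
have [j [/andP[j0 j3] jk] lowj] := low k bk.
have eval : nim_add (word_nim 0 u) (nim_add (nim_mod4 k) (word_nim 0 v)) = word_nim 0 w.
  by rewrite -(word_nim_pad w) ew word_nim_cat word_nim_nseq.
have {lowj} := lowj _ _ eval.
(* Of the run, [k'] letters are kept and [j] are erased. *)
have wE := subnK jk; move: (k - j) wE => k' wE; clear jk bk eval.
subst k; rewrite nseqD -catA in ew; rewrite nseqD in uv.
(* If [u] is empty, the run starts right after the left padding and is shortened at its right end;
   [v] is then nonempty because [w] is not all true. *)
have [/nilP u0 | u0] := boolP (nilp u).
  subst u; rewrite /= nim_add0 => <-.
  case: v => [|x v] in ew uv *.
    by move: wF; rewrite uv // -nseqD mem_nseq andbF.
  case: j j0 j3 ew uv => [|[|[|[|//]]]] //= _ _ ew uv.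
  (* For [j = 1] the triple reaches one letter beyond the delimiter; that letter is [false] because
     TFT is excluded. *)
  - case: x in ew uv *.
      by case: (nTFT (false :: nseq k' true) v).
    exists (false :: nseq k' true), true, false, false, v; split=> //=.
    by rewrite nim_add0 word_nim_nseq /= !nim_add0.
  - exists (false :: nseq k' true), true, true, false, (x :: v); split=> //=.
    by rewrite nim_add0 word_nim_nseq /= !nim_add0.
  - exists (false :: nseq k' true), true, true, true, (false :: x :: v); split=> //=.
    by rewrite nim_add0 word_nim_nseq /= !nim_add0.
(* Otherwise the delimiter before the run is not padding, and the run is shortened at its left
   end. *)
case/lastP: u u0 ew {uv} => [//|u x] _ ew <-.
rewrite [nseq k' true ++ _]catA -nseqD addnC nseqD -catA in ew.
case: j j0 j3 ew => [|[|[|[|//]]]] //= _ _ ew.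
- have x0 : x = false.
    apply/negbTE/negP => xT; apply: (nTFT u (nseq k' true ++ false :: v)).
    by rewrite ew xT cat_rcons.
  exists u, x, false, true, (nseq k' true ++ false :: v); rewrite ew cat_rcons; split=> //=.
    by rewrite orbT.
  have -> : word_nim 0 (rcons u x) = word_nim 0 u.
    by rewrite x0 -cats1 word_nim_cat nim_addC; apply: nim_add0.
  by rewrite word_nim_cat /= !nim_add0 word_nim_nseq.
- exists (rcons u x), false, true, true, (nseq k' true ++ false :: v); rewrite ew; split=> //=.
  by rewrite word_nim_cat /= !nim_add0 word_nim_nseq.
- exists (rcons u x ++ [:: false]), true, true, true, (nseq k' true ++ false :: v); rewrite ew -catA; split=> //=.
  by rewrite -catA word_nim_cat /= !nim_add0 word_nim_nseq.
Qed.

(** * Positions on the path *)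

Section Path.
Variable n : nat.
Implicit Types (S : {set path_graph n}) (v : path_graph n).

(* Letter j of the word of S tells whether the vertex j - 1 is not dominated;
   the letters 0 and n + 1 are padding, so that playing v always means erasing
   the letters v, v + 1, v + 2. *)
Definition letter S (j : nat) : bool :=
  [&& 0 < j, j <= n & [forall u in S, ~~ (u <= j <= u.+2)]].

Definition inner_word S : seq bool := mkseq (fun j => letter S j.+1) n.
Definition word S : seq bool := mkseq (letter S) n.+2.

Lemma word_inner S : word S = false :: inner_word S ++ [:: false].
Proof.
have l0 : letter S 0 = false by [].
have ln : letter S n.+1 = false by rewrite /letter ltnn.
rewrite /word /inner_word /mkseq -(addn1 n.+1) iotaD map_cat /= add0n l0 ln.
by rewrite -addn1 addnC iotaDl -map_comp.
Qed.

Lemma dominates_path v (w : path_graph n) : dominates v w = (v <= w.+1 <= v.+2).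
Proof.
rewrite /dominates /edge /= /path_rel -val_eqE /=; lia.
Qed.

Lemma letter_vertex S (w : path_graph n) : letter S w.+1 = ~~ dominated S w.
Proof.
rewrite /letter ltn_ord /dominated negb_exists_in; apply: eq_forallb_in => u _.
by rewrite dominates_path.
Qed.

Lemma letter_play S v j : letter (v |: S) j = letter S j && ~~ (v <= j <= v.+2).
Proof.
rewrite /letter -!andbA; do 2!congr (_ && _); apply/forall_inP/andP.
  move=> H; split; last by apply: H; rewrite !inE eqxx.
  by apply/forall_inP => u uS; apply: H; rewrite !inE uS orbT.
move=> [/forall_inP H vj] u; rewrite !inE => /orP[/eqP-> //|]; exact: H.
Qed.

Lemma playable_letter S v :
  playable S v = [|| letter S v, letter S v.+1 | letter S v.+2].
Proof.
apply/existsP/or3P => [[w /andP[]] | H].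
  rewrite dominates_path -letter_vertex => vw lw.
  have: [|| w.+1 == v, w.+1 == v.+1 | w.+1 == v.+2] by lia.
  by case/or3P => /eqP e; rewrite e in lw; [apply: Or31 | apply: Or32 | apply: Or33].
have [j vj lj] : exists2 j, v <= j <= v.+2 & letter S j.
  by case: H => lj; [exists (v : nat) | exists v.+1 | exists v.+2] => //; lia.
have /and3P[j0 jn _] := lj; have lt_jn : j.-1 < n by lia.
exists (Ordinal lt_jn : path_graph n).
by rewrite dominates_path -letter_vertex /= prednK // vj.
Qed.

Lemma word_split S v : exists u w,
  word S = u ++ [:: letter S v; letter S v.+1; letter S v.+2] ++ w /\ size u = v.
Proof.
exists (mkseq (letter S) v), [seq letter S j | j <- iota v.+3 (n - v.+1)].
rewrite size_mkseq; split=> //; rewrite /word /mkseq.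
have -> : n.+2 = v + (3 + (n - v.+1)) by have := ltn_ord v; lia.
by rewrite iotaD map_cat iotaD map_cat /= add0n addn3.
Qed.

Lemma word_letter S u x w j : word S = u ++ x ++ w -> j < size x ->
  letter S (size u + j) = nth false x j.
Proof.
move=> eS ltj; have := congr1 size eS; rewrite size_mkseq !size_cat => sw.
rewrite -[LHS](@nth_mkseq _ false _ n.+2); last by lia.
by rewrite -/(word S) eS nth_cat ltnNge leq_addr addKn nth_cat ltj.
Qed.

Lemma word_play S v u a b c w :
    word S = u ++ [:: a; b; c] ++ w -> size u = v ->
  playable S v = [|| a, b | c] /\
  word (v |: S) = u ++ [:: false; false; false] ++ w.
Proof.
move=> eS su; have ltv := ltn_ord v.
have sw : size u + (3 + size w) = n.+2.
  by rewrite -[RHS](size_mkseq (letter S)) -/(word S) eS !size_cat.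
have nthS j : j < n.+2 -> letter S j = nth false (u ++ [:: a; b; c] ++ w) j.
  by move=> ltj; rewrite -eS nth_mkseq.
split.
  rewrite playable_letter -su -[X in letter S X || _]addn0 -addn2 -addn1.
  by rewrite !(word_letter eS).
apply: (@eq_from_nth _ false); first by rewrite size_mkseq !size_cat /= sw.
move=> j; rewrite size_mkseq => ltj; rewrite nth_mkseq // letter_play nthS //.
rewrite !nth_cat su; case: ltnP => lejv.
  by rewrite andbT.
have -> : (j <= v.+2) = (j - v <= 2) by lia.
by case: (j - v) => [|[|[|m]]]; rewrite /= ?andbF ?andbT.
Qed.

(** A selected vertex covers three consecutive letters, so if it covers the middle one it also
    covers a neighbour of it. The middle letter cannot be padding, as it lies between two
    vertices. *)
Lemma word_noTFT S u w : word S <> u ++ [:: true; false; true] ++ w.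
Proof.
move=> eS; have sw : size u + (3 + size w) = n.+2.
  by rewrite -[RHS](size_mkseq (letter S)) -/(word S) eS !size_cat.
have nthS j := @word_letter S u [:: true; false; true] w j eS.
have /and3P[v0 _ /forall_inP v1] := nthS 0 isT.
have /and3P[_ vn /forall_inP v2] := nthS 2 isT.
have := nthS 1 isT; rewrite /letter /= => /negbT.
have -> /= : 0 < size u + 1 by rewrite addn1.
have -> /= : size u + 1 <= n by apply: leq_trans vn; rewrite leq_add2l.
move=> /forall_inPn[s sS]; move: (v1 s sS) (v2 s sS).
by move: (size u) (nat_of_ord s) => k l; clear; lia.
Qed.

(** The nim-sum is the mex of the options: the Nim strategy reaches all smaller values, and no move
    preserves the value. *)
Lemma nimber_word S : S != set0 ->
  nimber S = nim_nat (word_nim 0 (word S)).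
Proof.
have [m] := ubnP #|~: S|; elim: m S => // m IHm S ltSm S0.
have IH v : playable S v -> nimber (v |: S) = nim_nat (word_nim 0 (word (v |: S))).
  move=> pv; apply: IHm; first exact: leq_trans (card_play pv) _.
  by apply/set0Pn; exists v; rewrite !inE eqxx.
have padded : word_nim 0 (word S) = word_nim 0 (inner_word S).
  by rewrite word_inner word_nim_pad.
rewrite nimberE; apply: mex_eq => [t | ].
  rewrite padded => lt_t.
  have [||u [a [b [c [w [eS abc <-]]]]]] := word_nim_reach _ _ lt_t.
  - by move=> u w; rewrite -word_inner; apply: word_noTFT.
  (* A selected vertex dominates itself, which gives a letter [false] inside the padding. *)
  - have /set0Pn[v vS] := S0; apply/mapP; exists (v : nat).
      by rewrite mem_iota /= ltn_ord.
    by rewrite letter_vertex; apply/esym/negbF/exists_inP; exists v => //; rewrite /dominates eqxx.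
  rewrite -word_inner in eS.
  have ltu : size u < n.
    by have := congr1 size eS; rewrite size_mkseq !size_cat /=; lia.
  have [pv ev] := word_play eS (erefl : size u = (Ordinal ltu : path_graph n)).
  apply/mapP; exists (Ordinal ltu : path_graph n); first by rewrite mem_filter pv abc mem_enum.
  by rewrite IH ?pv // ev.
apply/mapP => -[v]; rewrite mem_filter => /andP[pv _]; rewrite IH // => /nim_nat_inj.
have [u [w [eS su]]] := word_split S v.
have [pabc ->] := word_play eS su; rewrite eS => /esym.
apply: word_nim_erase; first by rewrite -pabc.
by move=> abc; rewrite abc in eS; apply: word_noTFT eS.
Qed.

(** * The first move *)

Lemma word_set0 : word set0 = false :: nseq n true ++ [:: false].
Proof.
rewrite word_inner; congr (_ :: _ ++ _); apply: (@eq_from_nth _ false).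
  by rewrite size_mkseq size_nseq.
move=> j; rewrite size_mkseq => ltj; rewrite nth_mkseq // nth_nseq ltj.
by rewrite /letter ltj; apply/forall_inP => u; rewrite inE.
Qed.

(** With vertices counted from 0, the move [v] leaves runs of lengths [v - 1] and [n - v - 2];
    truncation at 0 accounts for moves near an end. *)
Lemma nimber_first v :
  nimber [set v] = nim_nat (nim_add (nim_mod4 v.-1) (nim_mod4 (n - v.+2))).
Proof.
rewrite nimber_word; last by apply/set0Pn; exists v; rewrite inE.
have [u [w [e0 su]]] := word_split set0 v.
have [_] := word_play e0 su; rewrite setU0 => ->.
have /(congr1 (take v)) := e0; rewrite take_size_cat // => <-.
have /(congr1 (drop v.+3)) := e0.
rewrite catA drop_size_cat ?size_cat ?su ?addn3 // => <-.
rewrite word_set0 word_nim_cat /= !nim_add0; congr (nim_nat (nim_add _ _)).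
  case: v {e0 su} => [[|j] ltj] //=.
  have lej : j <= n := ltnW (ltnW ltj).
  rewrite takel_cat ?size_nseq // take_nseq // -[nseq _ _]cats0 word_nim_nseq.
  exact: nim_add0.
rewrite drop_cat size_nseq; case: ltnP => lev.
  by rewrite drop_nseq word_nim_nseq /= nim_addC nim_add0.
(* At most the right padding is left here. *)
rewrite (eqP (lev : n - v.+2 == 0)).
by case: (v.+2 - n) => [|[]].
Qed.

Lemma graph_nimber_path : graph_nimber (path_graph n) =
  mex [seq nim_nat (nim_add (nim_mod4 i.-1) (nim_mod4 (n - i.+2))) | i <- iota 0 n].
Proof.
rewrite /graph_nimber nimberE -val_enum_ord -map_comp.
rewrite (_ : [seq v <- _ | _] = enum 'I_n).
  by congr mex; apply: eq_map => v; rewrite setU0 nimber_first.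
apply/all_filterP/allP => v _; apply/existsP; exists v.
rewrite /dominates eqxx -letter_vertex /letter ltn_ord /=.
by apply/forall_inP => u; rewrite inE.
Qed.

End Path.

(** * Nimbers of paths by residue modulo 4 *)

Lemma graph_nimber_path_modn n : 4 <= n ->
  graph_nimber (path_graph n) = nth 0 [:: 0; 1; 1; 3] (n %% 4).
Proof.
move=> n4; rewrite graph_nimber_path; apply: mex_eq.
  move=> k ltk; have [i lti ei] : exists2 i, i < n &
      k = nim_nat (nim_add (nim_mod4 (i.-1 %% 4)) (nim_mod4 ((n - i.+2) %% 4))).
    (* First moves reaching each smaller value; [i = 2] leaves runs of lengths [1] and [n - 4],
       hence [4 <= n]. *)
    case e: (n %% 4) ltk (ltn_pmod n (isT : 0 < 4)) => [|[|[|[|//]]]] //=.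
    - case: k => // _ _; exists 2; first by lia.
      by rewrite (_ : (n - 4) %% 4 = 1) //; lia.
    - case: k => // _ _; exists 0; first by lia.
      by rewrite (_ : (n - 2) %% 4 = 0) //; lia.
    - case: k => [|[|[|//]]] _ _; [exists 1 | exists 0 | exists 2]; try lia.
      + by rewrite (_ : (n - 3) %% 4 = 0) //; lia.
      + by rewrite (_ : (n - 2) %% 4 = 1) //; lia.
      + by rewrite (_ : (n - 4) %% 4 = 3) //; lia.
  rewrite -!nim_mod4_modn in ei; apply/mapP; exists i => //.
  by rewrite mem_iota.
apply/mapP => -[i]; rewrite mem_iota /= add0n => lti.
rewrite (nim_mod4_modn i.-1) (nim_mod4_modn (n - i.+2)).
(* The cases are [i = 0], [i = n - 1], and an inner move, whose two runs have total length
   [n - 3]. *)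
have : [|| (i.-1 %% 4 == 0) && ((n - i.+2) %% 4 == (n - 2) %% 4),
           (i.-1 %% 4 == (n - 2) %% 4) && ((n - i.+2) %% 4 == 0) |
           (i.-1 %% 4 + (n - i.+2) %% 4) %% 4 == (n - 3) %% 4].
  lia.
have : n %% 4 < 4 by rewrite ltn_pmod.
(* Everything now depends on three remainders, which leaves a finite check. *)
have -> : (n - 2) %% 4 = (n %% 4 + 2) %% 4 by lia.
have -> : (n - 3) %% 4 = (n %% 4 + 1) %% 4 by lia.
have : i.-1 %% 4 < 4 by rewrite ltn_pmod.
have : (n - i.+2) %% 4 < 4 by rewrite ltn_pmod.
move: (i.-1 %% 4) ((n - i.+2) %% 4) (n %% 4).
by case=> [|[|[|[|a]]]] [|[|[|[|b]]]] [|[|[|[|c]]]].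
Qed.

Theorem theorem3 :
  [/\ graph_nimber (path_graph 1) = 1,
      graph_nimber (path_graph 2) = 1 &
      graph_nimber (path_graph 3) = 2] /\
  (forall n : nat, 4 <= n ->
    [/\ n %% 4 = 0 -> graph_nimber (path_graph n) = 0,
        n %% 4 = 1 -> graph_nimber (path_graph n) = 1,
        n %% 4 = 2 -> graph_nimber (path_graph n) = 1 &
        n %% 4 = 3 -> graph_nimber (path_graph n) = 3]) /\
  (forall n : nat, wins_game (path_graph n) Bob <-> 4 %| n).
Proof.
have P1 : graph_nimber (path_graph 1) = 1.
  by rewrite graph_nimber_path; apply: mex_eq => // -[].
have P2 : graph_nimber (path_graph 2) = 1.
  by rewrite graph_nimber_path; apply: mex_eq => // -[].
have P3 : graph_nimber (path_graph 3) = 2.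
  by rewrite graph_nimber_path; apply: mex_eq => // -[|[]].
split=> //; split=> [n n4 | n].
  by split=> e; rewrite graph_nimber_path_modn // e.
rewrite wins_game_Bob; case: (leqP 4 n) => [n4 | ].
  rewrite graph_nimber_path_modn // /dvdn.
  by case: (n %% 4) (ltn_pmod n (isT : 0 < 4)) => [|[|[|[|//]]]].
case: n => [|[|[|[|//]]]] _; rewrite ?P1 ?P2 ?P3 //.
(* For [n = 0] there is no first move, and 4 divides 0. *)
by rewrite graph_nimber_path mex_nil.
Qed.
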